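(* Let $r\ge1$ and let $\bm{\mu}=(\mu_1,\dots,\mu_r)$ be a perfect system of linear functionals. Let $\Phi(x)=\prod_{k=1}^N(x-z_k)$ and $\Psi_j(x)=\prod_{k=1}^{M_j}(x-w_{j,k})$ ($j=1,\dots,r$) be complex polynomials, each having only simple zeros (different polynomials may share zeros), and put $\bm{M}=(M_1,\dots,M_r)$. Let $\widetilde{\bm{\mu}}=(\widetilde\mu_1,\dots,\widetilde\mu_r)$ be any system of linear functionals with $\Psi_j\widetilde\mu_j=\Phi\mu_j$, and let $\check\mu_1,\dots,\check\mu_r$ be any linear functionals with $\Phi\check\mu_j=\widetilde\mu_j$, $j=1,\dots,r$. For $\bm{n}\in\mathbb{N}^r$ let $P_{\bm{n}}$ be the monic (normalized) type II polynomial of $\bm{\mu}$, and set $$Q^{(j)}_{\bm{n}}(w_{j,k})=\check\mu_j\left[P_{\bm{n}}(x)\frac{\Psi_j(x)}{x-w_{j,k}}\right],\qquad k=1,\dots,M_j,\ j=1,\dots,r.$$ Write $P_{\bm{n}}(\bm{z})$ for the column vector $(P_{\bm{n}}(z_1),\dots,P_{\bm{n}}(z_N))^T$ and $Q^{(j)}_{\bm{n}}(\bm{w}_j)$ for the column vector $(Q^{(j)}_{\bm{n}}(w_{j,1}),\dots,Q^{(j)}_{\bm{n}}(w_{j,M_j}))^T$. (1) Let $\bm{n}\in\mathbb{N}^r$ with $\bm{n}\ge\bm{M}$, let $\bm{m}\in\mathbb{N}^r$ with $|\bm{m}|=|\bm{n}|+N$ and $\bm{m}\ge\bm{n}-\bm{M}$,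 and let $\{\bm{m}-\bm{s}_i\}_{i=0}^{N+|\bm{M}|}$ be an admissible sequence from $\bm{m}$ towards $\bm{n}-\bm{M}$. Then $$\widetilde P_{\bm{n}}(x)=\Phi(x)^{-1}\det\begin{pmatrix} P_{\bm{m}}(x)&P_{\bm{m}-\bm{s}_1}(x)&\cdots&P_{\bm{m}-\bm{s}_{N+|\bm{M}|}}(x)\\ P_{\bm{m}}(\bm{z})&P_{\bm{m}-\bm{s}_1}(\bm{z})&\cdots&P_{\bm{m}-\bm{s}_{N+|\bm{M}|}}(\bm{z})\\ Q^{(1)}_{\bm{m}}(\bm{w}_1)&Q^{(1)}_{\bm{m}-\bm{s}_1}(\bm{w}_1)&\cdots&Q^{(1)}_{\bm{m}-\bm{s}_{N+|\bm{M}|}}(\bm{w}_1)\\ \vdots&\vdots&\ddots&\vdots\\ Q^{(r)}_{\bm{m}}(\bm{w}_r)&Q^{(r)}_{\bm{m}-\bm{s}_1}(\bm{w}_r)&\cdots&Q^{(r)}_{\bm{m}-\bm{s}_{N+|\bm{M}|}}(\bm{w}_r) \end{pmatrix}$$ is a polynomial satisfying the type II orthogonality conditions $\widetilde\mu_j[\widetilde P_{\bm{n}}(x)x^p]=0$ for $p=0,\dots,n_j-1$, $j=1,\dots,r$, and the type II degree condition $\deg\widetilde P_{\bm{n}}\le|\bm{n}|$. The index $\bm{n}$ is normal for $\widetilde{\bm{\mu}}$ if and only if $D^{(II)}_{\bm{n}}\ne0$, where $$D^{(II)}_{\bm{n}}=\det\begin{pmatrix} P_{\bm{m}-\bm{s}_1}(\bm{z})&\cdots&P_{\bm{m}-\bm{s}_{N+|\bm{M}|}}(\bm{z})\\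 Q^{(1)}_{\bm{m}-\bm{s}_1}(\bm{w}_1)&\cdots&Q^{(1)}_{\bm{m}-\bm{s}_{N+|\bm{M}|}}(\bm{w}_1)\\ \vdots&\ddots&\vdots\\ Q^{(r)}_{\bm{m}-\bm{s}_1}(\bm{w}_r)&\cdots&Q^{(r)}_{\bm{m}-\bm{s}_{N+|\bm{M}|}}(\bm{w}_r) \end{pmatrix},$$ and then $\frac{1}{D^{(II)}_{\bm{n}}}\widetilde P_{\bm{n}}$ is the (unique) normalized (monic, degree $|\bm{n}|$) type II polynomial for the index $\bm{n}$ with respect to $\widetilde{\bm{\mu}}$. (2) Let $\bm{n}\in\mathbb{N}^r$ with $n_j<M_j$ for some $j$. Put $\bm{M}^*=(M_1^*,\dots,M_r^* )$ with $M_j^*=\min(n_j,M_j)$, let $\bm{m}\in\mathbb{N}^r$ with $|\bm{m}|=|\bm{n}|+N$ and $\bm{m}\ge\bm{n}-\bm{M}^*$, and let $\{\bm{m}-\bm{s}_i\}_{i=0}^{N+|\bm{M}^*|}$ be an admissible sequence from $\bm{m}$ towards $\bm{n}-\bm{M}^*$. For $i=N+|\bm{M}^*|+1,\dots,N+|\bm{M}|$ (where the subscript $\bm{m}-\bm{s}_i$ is only a label) put $P_{\bm{m}-\bm{s}_i}=0$ and $$\begin{pmatrix} Q^{(1)}_{\bm{m}-\bm{s}_{N+|\bm{M}^*|+1}}(\bm{w}_1)&\cdots&Q^{(1)}_{\bm{m}-\bm{s}_{N+|\bm{M}|}}(\bm{w}_1)\\ \vdots&\ddots&\vdots\\ Q^{(r)}_{\bm{m}-\bm{s}_{N+|\bm{M}^*|+1}}(\bm{w}_r)&\cdots&Q^{(r)}_{\bm{m}-\bm{s}_{N+|\bm{M}|}}(\bm{w}_r)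 \end{pmatrix}=\operatorname{diag}(W_1,\dots,W_r),$$ where for each $j$ with $n_j<M_j$, $W_j$ is the $M_j\times(M_j-n_j)$ matrix with entries $(W_j)_{k,l}=w_{j,k}^{\,l-1}$, $1\le k\le M_j$, $1\le l\le M_j-n_j$. For $j$ with $n_j\ge M_j$ the block $W_j$ is empty ($M_j\times0$), i.e. it contributes no columns and the corresponding $M_j$ rows of $\operatorname{diag}(W_1,\dots,W_r)$ are zero. All entries outside the blocks are zero. With these quantities define $$\widetilde P_{\bm{n}}(x)=\Phi(x)^{-1}\det\begin{pmatrix} P_{\bm{m}}(x)&P_{\bm{m}-\bm{s}_1}(x)&\cdots&P_{\bm{m}-\bm{s}_{N+|\bm{M}|}}(x)\\ P_{\bm{m}}(\bm{z})&P_{\bm{m}-\bm{s}_1}(\bm{z})&\cdots&P_{\bm{m}-\bm{s}_{N+|\bm{M}|}}(\bm{z})\\ Q^{(1)}_{\bm{m}}(\bm{w}_1)&Q^{(1)}_{\bm{m}-\bm{s}_1}(\bm{w}_1)&\cdots&Q^{(1)}_{\bm{m}-\bm{s}_{N+|\bm{M}|}}(\bm{w}_1)\\ \vdots&\vdots&\ddots&\vdots\\ Q^{(r)}_{\bm{m}}(\bm{w}_r)&Q^{(r)}_{\bm{m}-\bm{s}_1}(\bm{w}_r)&\cdots&Q^{(r)}_{\bm{m}-\bm{s}_{N+|\bm{M}|}}(\bm{w}_r) \end{pmatrix}$$ and $$D^{(II)}_{\bm{n}}=\det\begin{pmatrix} P_{\bm{m}-\bm{s}_1}(\bm{z})&\cdots&P_{\bm{m}-\bm{s}_{N+|\bm{M}|}}(\bm{z})\\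 Q^{(1)}_{\bm{m}-\bm{s}_1}(\bm{w}_1)&\cdots&Q^{(1)}_{\bm{m}-\bm{s}_{N+|\bm{M}|}}(\bm{w}_1)\\ \vdots&\ddots&\vdots\\ Q^{(r)}_{\bm{m}-\bm{s}_1}(\bm{w}_r)&\cdots&Q^{(r)}_{\bm{m}-\bm{s}_{N+|\bm{M}|}}(\bm{w}_r) \end{pmatrix}.$$ Then $\widetilde P_{\bm{n}}$ is a polynomial satisfying $\widetilde\mu_j[\widetilde P_{\bm{n}}(x)x^p]=0$ for $p=0,\dots,n_j-1$, $j=1,\dots,r$, and $\deg\widetilde P_{\bm{n}}\le|\bm{n}|$; the index $\bm{n}$ is normal for $\widetilde{\bm{\mu}}$ if and only if $D^{(II)}_{\bm{n}}\ne0$; and then $\frac{1}{D^{(II)}_{\bm{n}}}\widetilde P_{\bm{n}}$ is the (unique) normalized (monic, degree $|\bm{n}|$) type II polynomial for the index $\bm{n}$ with respect to $\widetilde{\bm{\mu}}$.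
   Context: $\mathbb{N}=\{0,1,2,\dots\}$. For $\bm{n}=(n_1,\dots,n_r)\in\mathbb{N}^r$, $|\bm{n}|=n_1+\cdots+n_r$; inequalities between multi-indices are componentwise; $(\bm{s})_k$ is the $k$-th component of $\bm{s}$. A linear functional means a complex linear functional on the space $\mathbb{C}[x]$ of polynomials (no positivity assumed). For a polynomial $\Phi$ and a functional $\mu$, $\Phi\mu$ is the functional $(\Phi\mu)[P]=\mu[\Phi P]$. Type II polynomials of a system of functionals $\bm{\mu}=(\mu_1,\dots,\mu_r)$ for the index $\bm{n}$: non-zero polynomials $P_{\bm{n}}$ with $\deg P_{\bm{n}}\le|\bm{n}|$ and $\mu_j[P_{\bm{n}}(x)x^p]=0$ for $p=0,\dots,n_j-1$, $j=1,\dots,r$. Normality: with moments $\nu^{(j)}_k=\mu_j[x^k]$, the index $\bm{n}\ne\bm{0}$ is normal for $\bm{\mu}$ if $\det H_{\bm{n}}\ne0$, where $H_{\bm{n}}$ is the $|\bm{n}|\times|\bm{n}|$ matrix formed by stacking, for $j=1,\dots,r$, the rows $(\nu^{(j)}_{p},\nu^{(j)}_{p+1},\dots,\nu^{(j)}_{p+|\bm{n}|-1})$, $p=0,\dots,n_j-1$. Equivalently, there is a unique monic type II polynomial of degree $|\bm{n}|$ for $\bm{n}$ (the normalized type II polynomial); equivalently, every type II polynomial for $\bm{n}$ has degree exactly $|\bm{n}|$. The index $\bm{0}$ is always normal. The system $\bm{\mu}$ is perfect if every $\bm{n}\in\mathbb{N}^r$ is normal. Admissible (decreasing) sequence: for $\bm{n}\ge\bm{m}$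 in $\mathbb{N}^r$ and $d=|\bm{n}|-|\bm{m}|$, a sequence $\{\bm{n}-\bm{s}_j\}_{j=0}^d$ of multi-indices is an admissible sequence from $\bm{n}$ towards $\bm{m}$ if $\bm{s}_0=\bm{0}$, $\bm{m}\le\bm{n}-\bm{s}_j\le\bm{n}$ for $j=1,\dots,d$, and for some $k_1,\dots,k_d\in\{1,\dots,r\}$ one has $(\bm{s}_i)_{k_j}<(\bm{s}_j)_{k_j}$ for all $0\le i<j\le d$. (It need not pass through $\bm{m}$.) *)

(* Defs.v *)
From HB Require Import structures.
From mathcomp Require Import all_boot all_order all_algebra.
From mathcomp Require Import reals complex.

Set Implicit Arguments.
Unset Strict Implicit.
Unset Printing Implicit Defensive.

Import Order.TTheory GRing.Theory Num.Theory.
Local Open Scope ring_scope.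

Definition mindex (r : nat) := {ffun 'I_r -> nat}.

Notation weight n := (\sum_j n j)%N.

Definition mi_le (r : nat) (m n : mindex r) : Prop :=
  forall j : 'I_r, (m j <= n j)%N.

(* Truncated subtraction: only meaningful when [mi_le n m]. *)
Definition mi_sub (r : nat) (m n : mindex r) : mindex r :=
  [ffun j => (m j - n j)%N].

Definition mi_min (r : nat) (m n : mindex r) : mindex r :=
  [ffun j => minn (m j) (n j)].

(* {n - s_j}, 0 <= j <= d := |n| - |m|, is admissible from n towards m.
   Only the values s 0, ..., s d matter.  The first inequality in the second
   clause makes the truncated subtraction in the next one exact; n - s_j <= n
   is automatic, as s_j has nonnegative components. *)
Definition admissible (r : nat) (n m : mindex r) (s : nat -> mindex r) : Prop :=
  let d := (weight n - weight m)%N in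
  [/\ s 0%N = [ffun=> 0%N],
      forall j, (0 < j <= d)%N -> mi_le (s j) n /\ mi_le m (mi_sub n (s j))
    & exists k : nat -> 'I_r,
        forall i j, (i < j)%N -> (j <= d)%N -> (s i (k j) < s j (k j))%N].

Definition functional (F : fieldType) := {scalar {poly F}}.

Definition mulfun (F : fieldType) (Phi : {poly F}) (mu : functional F) :
  {poly F} -> F := fun P => mu (Phi * P).

Definition typeII_orth (F : fieldType) (r : nat) (mu : 'I_r -> functional F)
    (n : mindex r) (P : {poly F}) : Prop :=
  forall (j : 'I_r) (p : nat), (p < n j)%N -> mu j (P * 'X^p) = 0.

Definition normalized_typeII (F : fieldType) (r : nat)
    (mu : 'I_r -> functional F) (n : mindex r) (P : {poly F}) : Prop :=
  [/\ P \is monic, size P = (weight n).+1 & typeII_orth mu n P].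

Definition hankel_mx (F : fieldType) (r : nat) (mu : 'I_r -> functional F)
    (n : mindex r) : 'M[F]_(weight n) :=
  \mxcol_(j < r) \matrix_(p < n j, q < weight n) mu j 'X^(p + q).

(* For n = 0 the matrix is 0 x 0 with determinant 1, so that 0 is normal. *)
Definition normal (F : fieldType) (r : nat) (mu : 'I_r -> functional F)
    (n : mindex r) : Prop := \det (hankel_mx mu n) != 0.

Definition perfect (F : fieldType) (r : nat) (mu : 'I_r -> functional F) : Prop :=
  forall n : mindex r, normal mu n.

Definition root_poly (F : fieldType) (N : nat) (z : 'I_N -> F) : {poly F} :=
  \prod_(k < N) ('X - (z k)%:P).

(* The column (P(z), Q^(1)(w_1), ..., Q^(r)(w_r)) attached to a polynomial P,
   where Q^(j)(w_{j,k}) = cmu_j[P Psi_j / (x - w_{j,k})]; the quotient is exact. *)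
Definition data_col (F : fieldType) (r N : nat) (M : mindex r)
    (z : 'I_N -> F) (w : forall j : 'I_r, 'I_(M j) -> F)
    (cmu : 'I_r -> functional F) (P : {poly F}) : 'cV[F]_(N + weight M) :=
  col_mx
    (\col_k P.[z k])
    (\mxcol_(j < r) \col_(k < M j)
       cmu j (P * (root_poly (w j) %/ ('X - (w j k)%:P)))).

Definition data_mx (F : fieldType) (r N : nat) (M : mindex r)
    (z : 'I_N -> F) (w : forall j : 'I_r, 'I_(M j) -> F)
    (cmu : 'I_r -> functional F) (P : mindex r -> {poly F})
    (m : mindex r) (s : nat -> mindex r) (d : nat) : 'M[F]_(N + weight M, d) :=
  \matrix_(a < N + weight M, i < d)
    data_col z w cmu (P (mi_sub m (s i.+1))) a 0.

Definition poly_row (F : fieldType) (r : nat) (P : mindex r -> {poly F})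
    (m : mindex r) (s : nat -> mindex r) (d : nat) : 'rV[{poly F}]_d :=
  \row_(i < d) P (mi_sub m (s i.+1)).

Definition border_det (F : fieldType) (d : nat) (p : {poly F})
    (ps : 'rV[{poly F}]_d) (v : 'cV[F]_d) (A : 'M[F]_d) : {poly F} :=
  \det (block_mx (p%:M : 'M[{poly F}]_1) ps
                 (map_mx polyC v)        (map_mx polyC A)).

(* diag(W_1, ..., W_r), with W_j = (w_{j,k}^l), k < M_j, l < M_j - n_j; by
   truncated subtraction W_j has no column when M_j <= n_j. *)
Definition W_diag (F : fieldType) (r : nat) (M n : mindex r)
    (w : forall j : 'I_r, 'I_(M j) -> F) :
  'M[F]_(weight M, \sum_(j < r) (M j - n j)) :=
  \mxblock_(i < r, j < r)
    \matrix_(k < M i, l < M j - n j) (if i == j then w i k ^+ l else 0).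

Lemma label_count (r N : nat) (M n : mindex r) :
  (N + weight (mi_min n M) + \sum_(j < r) (M j - n j) = N + weight M)%N.
Proof.
rewrite -addnA -big_split /=; congr (_ + _)%N.
by apply: eq_bigr => j _; rewrite ffunE minnC minnE subnK ?leq_subr.
Qed.

(* First row and lower rows (without the column of P_m) when n_j < M_j for some
   j: the last |M| - |M^*| columns are (0, 0, diag(W_1, ..., W_r)). *)
Definition poly_row_ext (F : fieldType) (r N : nat) (M n : mindex r)
    (P : mindex r -> {poly F}) (m : mindex r) (s : nat -> mindex r) :
  'rV[{poly F}]_(N + weight M) :=
  castmx (erefl, label_count N M n)
    (row_mx (poly_row P m s (N + weight (mi_min n M))) 0).

Definition data_mx_ext (F : fieldType) (r N : nat) (M n : mindex r)
    (z : 'I_N -> F) (w : forall j : 'I_r, 'I_(M j) -> F)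
    (cmu : 'I_r -> functional F) (P : mindex r -> {poly F})
    (m : mindex r) (s : nat -> mindex r) : 'M[F]_(N + weight M) :=
  castmx (erefl, label_count N M n)
    (row_mx (data_mx z w cmu P m s (N + weight (mi_min n M)))
            (col_mx 0 (W_diag n w))).

(* tP stands for Phi^-1 * Delta: the quotient is exact by the first clause.
   D is the determinant D_n^(II). *)
Definition christoffel_conclusion (F : fieldType) (r : nat)
    (tmu : 'I_r -> functional F) (n : mindex r)
    (Phi Delta : {poly F}) (D : F) : Prop :=
  let tP := Delta %/ Phi in
  [/\ Phi %| Delta,
      typeII_orth tmu n tP,
      (size tP <= (weight n).+1)%N,
      normal tmu n <-> D != 0
    & D != 0 ->
        normalized_typeII tmu n (D^-1 *: tP) /\
        (forall P, normalized_typeII tmu n P -> P = D^-1 *: tP)].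

(* Main.v *)
(* Let V be the space of polynomials G of degree <= |n| + N that satisfy the
   mu_j-orthogonality of order n_j - min(n_j, M_j) for every j.  Perfectness and
   admissibility make P_m, P_{m - s_1}, ... a basis of V: the functionals
   G |-> mu_{k_j}[G x^{(m - s_j)_{k_j}}], together with the x^|m|-coefficient,
   are triangular and unisolvent on it.
   A polynomial T is type II for (tmu, n) iff G = Phi T lies in V, vanishes at
   the z_k, and for every j the vector (Q^(j)(w_{j,k}))_k of G is in the column
   span of W_j.  Hence the linear relations between the columns of the lower
   rows of the determinant correspond bijectively to the type II polynomials
   for n; the cofactors of the first row form such a relation, whose coefficient
   of P_m, i.e. the x^|n|-coefficient of the associated T, is D. *)

Require Import Defs.
From HB Require Import structures.
From mathcomp Require Import all_boot all_order all_algebra.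
From mathcomp Require Import ring zify.
From mathcomp Require Import reals complex.

Set Implicit Arguments.
Unset Strict Implicit.
Unset Printing Implicit Defensive.

Import Order.TTheory GRing.Theory Num.Theory.
Local Open Scope ring_scope.

(** * Functionals and polynomials with prescribed simple roots *)

(** Makes [T tmu_j] a functional again, so that the moment lemmas below apply to it. *)
Lemma mulfun_is_linear (F : fieldType) (T : {poly F}) (L : functional F) :
  scalar (mulfun T L).
Proof. by move=> a f g; rewrite /mulfun mulrDr -scalerAr linearP. Qed.

HB.instance Definition _ (F : fieldType) (T : {poly F}) (L : functional F) :=
  GRing.isLinear.Build F {poly F} F *%R (mulfun T L) (mulfun_is_linear T L).

Lemma functionalE (F : fieldType) (L : functional F) (f : {poly F}) d :
  (size f <= d)%N -> L f = \sum_(i < d) f`_i * L 'X^i.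
Proof.
move=> sf; rewrite -{1}(take_poly_id sf) /take_poly poly_def linear_sum /=.
by apply: eq_bigr => i _; rewrite linearZ.
Qed.

Lemma functional_eq0 (F : fieldType) (L : functional F) (f : {poly F}) d :
  (size f <= d)%N -> (forall i, (i < d)%N -> L 'X^i = 0) -> L f = 0.
Proof.
by move=> sf L0; rewrite (functionalE L sf) big1 // => i _; rewrite L0 ?mulr0.
Qed.

Lemma size_root_poly (F : fieldType) d (w : 'I_d -> F) :
  size (root_poly w) = d.+1.
Proof.
by rewrite /root_poly -big_enum /= size_prod_XsubC size_enum_ord.
Qed.

Lemma root_poly_monic (F : fieldType) d (w : 'I_d -> F) : root_poly w \is monic.
Proof. exact: monic_prod_XsubC. Qed.

Lemma root_root_poly (F : fieldType) d (w : 'I_d -> F) k :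
  root (root_poly w) (w k).
Proof. by rewrite /root_poly (bigD1 k) //= rootM root_XsubC eqxx. Qed.

Lemma root_poly_dvdp (F : fieldType) d (w : 'I_d -> F) (p : {poly F}) :
  injective w -> (forall k, root p (w k)) -> root_poly w %| p.
Proof.
move=> w_inj p0; rewrite /root_poly -(big_map w xpredT (fun c => 'X - c%:P)).
apply: uniq_roots_dvdp; first by apply/allP => _ /mapP[k _ ->].
by rewrite uniq_rootsE map_inj_uniq // index_enum_uniq.
Qed.

Lemma poly_eq0_roots (F : fieldType) d (w : 'I_d -> F) (p : {poly F}) :
  injective w -> (size p <= d)%N -> (forall k, root p (w k)) -> p = 0.
Proof.
move=> w_inj sp p0; apply/eqP; apply: contraTT sp => p_neq0; rewrite -ltnNge.
by rewrite -(size_root_poly w) dvdp_leq // root_poly_dvdp.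
Qed.

(** * Vandermonde systems, Horner quotients and vanishing moments *)

(** The sums are the values, at [d] distinct nodes, of the polynomial with coefficients [c l], whose
    degree is below [e <= d]. *)
Lemma vandermonde_eq0 (F : fieldType) d (w : 'I_d -> F) e (c : nat -> F) :
  injective w -> (e <= d)%N -> (forall k, \sum_(l < e) w k ^+ l * c l = 0) ->
  forall l, (l < e)%N -> c l = 0.
Proof.
move=> w_inj le_ed c0 l lt_le.
have q0 : \poly_(i < e) c i = 0.
  apply: (poly_eq0_roots w_inj); first exact: leq_trans (size_poly _ _) le_ed.
  move=> k; apply/rootP; rewrite horner_poly -[RHS](c0 k).
  by apply: eq_bigr => i _; rewrite mulrC.
by move: (coef_poly e c l); rewrite q0 coef0 lt_le.
Qed.

(* Horner's scheme: [drop_poly l.+1 p] is the coefficient of [c ^ l] in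
   [(p(x) - p(c)) / (x - c)]. *)
Lemma divp_XsubC (F : fieldType) (p : {poly F}) (c : F) d :
  (size p <= d.+1)%N -> root p c ->
  p %/ ('X - c%:P) = \sum_(l < d) c ^+ l *: drop_poly l.+1 p.
Proof.
move=> sp /rootP pc0.
have horner_scheme e : (\sum_(l < e) c ^+ l *: drop_poly l.+1 p) * ('X - c%:P) =
    p - c ^+ e *: drop_poly e p - (\sum_(l < e) p`_l * c ^+ l)%:P.
  elim: e => [|e IHe].
    by rewrite !big_ord0 drop_poly0l expr0 scale1r mul0r subrr subr0.
  rewrite !big_ord_recr /= mulrDl {}IHe polyCD polyCM -!mul_polyC exprS polyCM.
  have dropX : drop_poly e p = drop_poly e.+1 p * 'X + (p`_e)%:P.
    apply/polyP => -[|i]; rewrite coefD coefMX !coef_drop_poly coefC /=.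
      by rewrite add0r.
    by rewrite addr0 addSnnS.
  by rewrite dropX; ring.
(* At [e = d.+1] both remainders vanish: the constant is [p.[c] = 0], and [drop_poly d.+1 p = 0] by
   the size bound, which also removes the summand [l = d]. *)
have := horner_scheme d.+1; rewrite drop_poly_eq0 // scaler0 subr0.
rewrite -horner_coef_wide // pc0 subr0 big_ord_recr /= drop_poly_eq0 //.
rewrite scaler0 addr0 => {1}<-.
by rewrite mulpK // polyXsubC_eq0.
Qed.

(* [drop_poly l.+1 Psi] is monic of degree [d - l - 1], so [L] kills all
   polynomials of degree [< minn n d] iff the coefficients below vanish for
   [l >= d - n]; by Vandermonde they are determined by the left-hand sides. *)
Lemma functional_divp (F : fieldType) d (w : 'I_d -> F) (L : functional F) k :
  L (root_poly w %/ ('X - (w k)%:P)) =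
  \sum_(l < d) w k ^+ l * L (drop_poly l.+1 (root_poly w)).
Proof.
rewrite (@divp_XsubC _ _ _ d) ?size_root_poly ?root_root_poly // linear_sum /=.
by apply: eq_bigr => l _; rewrite linearZ.
Qed.

Lemma functional_divp_powers (F : fieldType) d (w : 'I_d -> F)
    (L : functional F) n :
  (forall p, (p < n)%N -> L 'X^p = 0) ->
  forall k, L (root_poly w %/ ('X - (w k)%:P)) =
    \sum_(l < d - n) w k ^+ l * L (drop_poly l.+1 (root_poly w)).
Proof.
move=> L0 k; rewrite functional_divp.
rewrite -!(big_mkord xpredT (fun l => w k ^+ l * L (drop_poly l.+1 (root_poly w)))).
rewrite (@big_cat_nat _ _ _ (d - n)) //= ?leq_subr // [X in _ + X]big_nat_cond.
rewrite [X in _ + X]big1 ?addr0 // => l /andP[/andP[le_l lt_l] _].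
rewrite (functional_eq0 _ L0) ?mulr0 // size_drop_poly size_root_poly.
by rewrite subSS leq_subLR addnC -leq_subLR.
Qed.

(** Converse of [functional_divp_powers]. With [Psi = root_poly w], the [drop_poly l.+1 Psi] for
    [d - n <= l < d] are monic of degrees [0, ..., minn n d - 1], and the [Psi * 'X^p] for
    [p < n - d] are monic of degrees [d, ..., n - 1]. [L] kills all of them, and together they span
    the degrees below [n]. *)
Lemma functional_vanish (F : fieldType) d (w : 'I_d -> F) (L : functional F) n
    (g : nat -> F) :
  injective w ->
  (forall k, L (root_poly w %/ ('X - (w k)%:P)) =
     \sum_(l < d - n) w k ^+ l * g l) ->
  (forall p, (p < n - d)%N -> L (root_poly w * 'X^p) = 0) ->
  forall p, (p < n)%N -> L 'X^p = 0.
Proof.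
move=> w_inj Lg Lmul.
have Ldrop l : (l < d)%N -> (d - n <= l)%N -> L (drop_poly l.+1 (root_poly w)) = 0.
  move=> lt_ld le_l.
  (* Padding [g] with zeros on [d - n <= l < d] makes both sums run over [l < d], so their
     difference is a full Vandermonde system. *)
  pose c l := L (drop_poly l.+1 (root_poly w)) - (if (l < d - n)%N then g l else 0).
  suff : c l = 0 by rewrite /c ltnNge le_l subr0.
  apply: (@vandermonde_eq0 _ _ w d c) => // k.
  under eq_bigr do rewrite mulrBr.
  rewrite sumrB -functional_divp Lg; apply/eqP; rewrite subr_eq0; apply/eqP.
  rewrite -(big_mkord xpredT (fun l => w k ^+ l * g l)).
  rewrite -(big_mkord xpredT (fun l => w k ^+ l * (if (l < d - n)%N then g l else 0))).
  rewrite (@big_cat_nat _ _ _ (d - n) 0 d) //= ?leq_subr //.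
  rewrite [X in _ = _ + X]big_nat_cond [X in _ = _ + X]big1 ?addr0.
    by apply: eq_big_nat => i /andP[_ ->].
  by move=> i /andP[/andP[le_i _] _]; rewrite ltnNge le_i mulr0.
have Lmonic p (f : {poly F}) : f \is monic -> size f = p.+1 ->
    (forall q, (q < p)%N -> L 'X^q = 0) -> L f = 0 -> L 'X^p = 0.
  move=> f_monic sf L0; rewrite (functionalE L (d := p.+1)) ?sf //.
  rewrite big_ord_recr /= big1 ?add0r => [|i _]; last by rewrite L0 ?mulr0.
  by have := monicP f_monic; rewrite lead_coefE sf /= => ->; rewrite mul1r.
elim/ltn_ind => p IHp lt_pn.
have L0 q : (q < p)%N -> L 'X^q = 0 by move=> lt_qp; apply/IHp/(ltn_trans _ lt_pn).
(* The monic polynomial of degree [p] killed by [L] is [root_poly w * 'X^(p - d)] if [d <= p], and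
   [drop_poly (d - p) (root_poly w)] otherwise; there [d - p = l.+1] with [d - n <= l] because
   [p < n]. *)
have [le_dp | lt_pd] := leqP d p.
  apply: (@Lmonic _ (root_poly w * 'X^(p - d))) => //.
  - by rewrite monicMr ?monicXn // root_poly_monic.
  - by rewrite size_mulXn ?monic_neq0 ?root_poly_monic // size_root_poly addnS subnK.
  - by apply: Lmul; rewrite ltn_sub2r // (leq_ltn_trans le_dp).
have s_drop : size (drop_poly (d - p) (root_poly w)) = p.+1.
  by rewrite size_drop_poly size_root_poly subSn ?leq_subr // subKn // ltnW.
apply: (@Lmonic _ (drop_poly (d - p) (root_poly w))) => //.
  apply/monicP; rewrite lead_coefE s_drop coef_drop_poly /= subnKC; last exact: ltnW.
  by have /monicP := root_poly_monic w; rewrite lead_coefE size_root_poly.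
have : (0 < d - p)%N by rewrite subn_gt0.
case E : (d - p)%N => [//|l] _; apply: Ldrop; last first.
  by rewrite -ltnS -E ltn_sub2l.
by rewrite -ltnS -E ltnS leq_subr.
Qed.

(** * Block products and bordered determinants *)

Lemma W_diagM (F : fieldType) (r : nat) (M n : mindex r)
    (w : forall j : 'I_r, 'I_(M j) -> F)
    (c : 'cV_(\sum_(j < r) (M j - n j))) j :
  submxcol (W_diag n w *m c) j =
  \col_k \sum_(l < M j - n j) w j k ^+ l * submxcol c j l 0.
Proof.
rewrite /W_diag -{1}[c]submxcolK mul_mxblock_mxrow mxcolK (bigD1 j) //=.
rewrite big1 ?addr0 => [|i ne_ij].
  by apply/colP => k; rewrite !mxE; apply: eq_bigr => l _; rewrite !mxE eqxx.
apply/matrixP => k u; rewrite !mxE big1 // => l _.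
by rewrite !mxE eq_sym (negPf ne_ij) mul0r.
Qed.

(** Expansion along the first row: its cofactors do not involve that row, so they are constants and
    agree with those of the scalar matrix [B] whose first row is zero. As [\det B = 0], they give a
    linear relation between the columns of the lower rows. *)
Lemma border_detE (F : fieldType) d (p : {poly F}) (ps : 'rV[{poly F}]_d)
    (v : 'cV[F]_d) (A : 'M[F]_d) :
  exists2 c : 'cV[F]_d, \det A *: v + A *m c = 0 &
    border_det p ps v A = \det A *: p + \sum_i c i 0 *: ps 0 i.
Proof.
pose B : 'M[F]_(1 + d) := block_mx 0 0 v A.
pose C : 'M[{poly F}]_(1 + d) :=
  block_mx p%:M ps (map_mx polyC v) (map_mx polyC A).
have row0 (T : Type) (X : 'M[T]_(1 + d)) : row' 0 X = dsubmx X.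
  by apply/matrixP => i k; rewrite !mxE; congr (X _ _); apply/val_inj.
have row_col0 (T : Type) (X : 'M[T]_(1 + d)) j :
    row' 0 (col' j X) = col' j (dsubmx X).
  by rewrite -row0; apply/matrixP => i k; rewrite !mxE.
have cofBC j : cofactor C 0 j = (cofactor B 0 j)%:P.
  rewrite -cofactor_map_mx; congr (_ * \det _).
  rewrite !row_col0 map_block_mx /C /block_mx !col_mxKd; reflexivity.
have cof0 : cofactor B 0 0 = \det A.
  rewrite /cofactor expr0 mul1r row_col0 /B /block_mx col_mxKd; congr (\det _).
  apply/matrixP => i k; rewrite mxE.
  have -> : lift 0 k = rshift 1 k by apply/val_inj.
  by rewrite row_mxEr.
have lshift0 : lshift d (0 : 'I_1) = 0 by apply/val_inj.
exists (\col_i cofactor B 0 (rshift 1 i)); last first.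
  rewrite /border_det -/C (expand_det_row C 0) big_split_ord /= big_ord1 !lshift0.
  congr (_ + _).
    rewrite cofBC cof0 -{1}lshift0 -{1}lshift0 block_mxEul mxE eqxx mulr1n.
    by rewrite mulrC mul_polyC.
  apply: eq_bigr => i _.
  by rewrite cofBC -{1}lshift0 block_mxEur mulrC mul_polyC mxE.
have detB : \det B = 0.
  rewrite (expand_det_row B 0) big1 // => j _.
  by rewrite -{1}lshift0 /B /block_mx col_mxEu row_mx0 mxE mul0r.
(* Column 0 of [\adj B] lists the cofactors of row 0, so the lower part of column 0 of
   [B *m \adj B = 0] is the desired relation. *)
have := congr1 (fun X => dsubmx (col 0 X)) (mul_mx_adj B).
rewrite detB.
have -> : col 0 (0%:M : 'M[F]_(1 + d)) = 0 by apply/colP => i; rewrite !mxE mul0rn.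
rewrite colE -mulmxA -colE -mul_dsub_mx /B /block_mx col_mxKd.
rewrite -[X in _ *m X](@vsubmxK _ 1 d) mul_row_col linear0 => eq0; rewrite -[RHS]eq0.
rewrite -cof0; congr (_ + _); last congr (_ *m _).
  by apply/colP => i; rewrite !mxE big_ord1 !mxE lshift0 mulrC.
by apply/colP => i; rewrite !mxE.
Qed.

(** * Normality and type II orthogonality *)

(** The matrix sends the coefficient vector of [P] to the values [mu j (P * 'X^p)], so its kernel
    consists of the type II orthogonal polynomials of degree below [weight n]. *)
Lemma normalP (F : fieldType) (r : nat) (mu : 'I_r -> functional F) n :
  normal mu n <->
  (forall P, typeII_orth mu n P -> (size P <= weight n)%N -> P = 0).
Proof.
have HE (c : 'cV_(weight n)) : hankel_mx mu n *m c =
    \mxcol_j \col_p mu j (rVpoly c^T * 'X^p).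
  rewrite /hankel_mx mxcol_mul; apply/eq_mxcolP => j.
  apply/colP => p; rewrite !mxE /rVpoly poly_def mulr_suml linear_sum /=.
  apply: eq_bigr => q _; rewrite -scalerAl linearZ /= mxE mulrC -exprD addnC.
  by case: insubP => [u _ /val_inj ->|]; rewrite ?mxE // ltn_ord.
rewrite /normal; split.
  move=> detH P P_orth sP; rewrite -(poly_rV_K sP) -[poly_rV P]trmxK.
  set c := (poly_rV P)^T; suff -> : c = 0 by rewrite trmx0 linear0.
  have : hankel_mx mu n *m c = 0.
    rewrite HE; apply/mxcolP => j; rewrite mxcolK submxcol0; apply/colP => p.
    by rewrite !mxE /c trmxK poly_rV_K // P_orth.
  move/(congr1 (mulmx (invmx (hankel_mx mu n)))).
  by rewrite mulKmx ?unitmxE ?unitfE // mulmx0.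
move=> orth0; rewrite -det_tr; apply/det0P => -[v v_neq0 vH].
case/eqP: v_neq0; rewrite -[v]rVpolyK.
have Hv : hankel_mx mu n *m v^T = 0 by rewrite -[LHS]trmxK trmx_mul trmxK vH trmx0.
rewrite (orth0 (rVpoly v)) ?linear0 ?size_poly // => j p lt_p.
move/(congr1 (fun X => submxcol X j (Ordinal lt_p) 0)): Hv.
by rewrite HE mxcolK submxcol0 trmxK !mxE.
Qed.
(** Reads the coefficient of [T] at [weight n] off [Phi * T], also when that coefficient is zero. *)
Lemma coef_monicM (F : fieldType) (p q : {poly F}) d k :
  p \is monic -> size p = d.+1 -> (size q <= k.+1)%N -> (p * q)`_(d + k) = q`_k.
Proof.
move=> p_monic sp sq; rewrite coefM.
have lt_d : (d < (d + k).+1)%N by rewrite ltnS leq_addr.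
rewrite (bigD1 (Ordinal lt_d)) //= addKn.
have := monicP p_monic; rewrite lead_coefE sp /= => ->; rewrite mul1r.
rewrite big1 ?addr0 // => i ne_i; have [le_id | lt_di] := leqP i d.
  rewrite [q`__]nth_default ?mulr0 //; apply: leq_trans sq _.
  by have : (i != d :> nat) by []; lia.
by rewrite [p`__]nth_default ?mul0r // sp.
Qed.

Lemma size_le_coef0 (F : fieldType) (p : {poly F}) k :
  (size p <= k.+1)%N -> p`_k = 0 -> (size p <= k)%N.
Proof.
move=> sp pk0; apply/leq_sizeP => i; rewrite leq_eqVlt => /predU1P[<- //|lt_ki].
by rewrite nth_default // (leq_trans sp).
Qed.

Lemma typeII_orth_comb (F : fieldType) (r : nat) (mu : 'I_r -> functional F) n
    (a : F) P Q :
  typeII_orth mu n P -> typeII_orth mu n Q -> typeII_orth mu n (a *: P + Q).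
Proof.
by move=> oP oQ j p lt_p; rewrite mulrDl -scalerAl linearP /= oP // oQ // mulr0 addr0.
Qed.

Lemma typeII_orth0 (F : fieldType) (r : nat) (mu : 'I_r -> functional F) n :
  typeII_orth mu n 0.
Proof. by move=> j p _; rewrite mul0r linear0. Qed.

Lemma typeII_orth_sum (F : fieldType) (r : nat) (mu : 'I_r -> functional F) n d
    (c : 'I_d -> F) (Q : 'I_d -> {poly F}) :
  (forall i, typeII_orth mu n (Q i)) -> typeII_orth mu n (\sum_i c i *: Q i).
Proof.
move=> oQ; apply: (big_ind (typeII_orth mu n)); first exact: typeII_orth0.
  by move=> P1 P2 o1 o2; rewrite -[P1]scale1r; apply: typeII_orth_comb.
by move=> i _; rewrite -[_ *: _]addr0; apply: typeII_orth_comb => //; apply: typeII_orth0.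
Qed.

Lemma typeII_orth_le (F : fieldType) (r : nat) (mu : 'I_r -> functional F) n n' P :
  mi_le n' n -> typeII_orth mu n P -> typeII_orth mu n' P.
Proof. by move=> le_n oP j p lt_p; apply: oP; apply: leq_trans (le_n j). Qed.

Lemma normalized_typeII_sub (F : fieldType) (r : nat) (mu : 'I_r -> functional F) n P Q :
  normalized_typeII mu n P -> normalized_typeII mu n Q ->
  typeII_orth mu n (P - Q) /\ (size (P - Q)%R <= weight n)%N.
Proof.
case=> mP sP oP [mQ sQ oQ]; split.
  by rewrite addrC -scaleN1r; apply: typeII_orth_comb.
apply: size_le_coef0.
  by rewrite (leq_trans (size_polyD _ _)) // size_polyN sP sQ maxnn.
have := monicP mP; have := monicP mQ.
by rewrite !lead_coefE sP sQ coefB /= => -> ->; rewrite subrr.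
Qed.

(** * From column relations to the Christoffel conclusion *)

(* The data column enters only through its linear relations: these correspond
   to the type II polynomials [T] of [tmu], by the expansion of [Phi * T]
   along [p] and [ps0]. *)
Lemma christoffel_of_relations (F : fieldType) (r : nat)
    (tmu : 'I_r -> functional F) (n : mindex r) N (Phi p : {poly F})
    d0 d (E : d0 = d) (ps0 : 'rV[{poly F}]_d0) (v : 'cV[F]_d)
    (A0 : 'M[F]_(d, d0)) :
  Phi \is monic -> size Phi = N.+1 ->
  p \is monic -> size p = (weight n + N).+1 ->
  (forall i, (size (ps0 0%R i) <= weight n + N)%N) ->
  (forall a c, a *: v + A0 *m c = 0 ->
     exists2 T : {poly F},
       a *: p + \sum_i c i 0 *: ps0 0 i = Phi * T & typeII_orth tmu n T) ->
  (forall T, typeII_orth tmu n T -> (size T <= (weight n).+1)%N ->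
     exists a c, a *: v + A0 *m c = 0 /\
       a *: p + \sum_i c i 0 *: ps0 0 i = Phi * T) ->
  (forall c : 'cV_d0, A0 *m c = 0 -> \sum_i c i 0 *: ps0 0 i = 0 -> c = 0) ->
  christoffel_conclusion tmu n Phi
    (border_det p (castmx (erefl, E) ps0) v (castmx (erefl, E) A0))
    (\det (castmx (erefl, E) A0)).
Proof.
(* With [d] a variable, [E] can be destructed and the casts disappear. *)
case: d / E v A0 => v A0; rewrite !castmx_id.
move=> Phi_monic sPhi p_monic sp sps relT Trel rel_inj.
have Phi_neq0 := monic_neq0 Phi_monic.
have comb_size a (c : 'cV_d0) :
    (size (a *: p + \sum_i c i 0 *: ps0 0 i)%R <= (N + weight n).+1)%N.
  rewrite [(N + _)%N]addnC (leq_trans (size_polyD _ _)) // geq_max -{1}sp size_scale_leq /=.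
  apply: leq_trans (size_sum _ _ _) _; apply/bigmax_leqP => i _.
  by apply: leq_trans (size_scale_leq _ _) _; apply: leqW.
have comb_coef a (c : 'cV_d0) : (a *: p + \sum_i c i 0 *: ps0 0 i)`_(N + weight n) = a.
  rewrite [(N + _)%N]addnC coefD coefZ coef_sum [X in _ + X]big1 ?addr0 => [|i _].
    by have := monicP p_monic; rewrite lead_coefE sp /= => ->; rewrite mulr1.
  by rewrite coefZ nth_default ?mulr0.
(* Among the expanding polynomials only [p] reaches degree [weight n + N], so its coefficient [a] is
   the top coefficient of [T]. *)
have quo a (c : 'cV_d0) (T : {poly F}) : a *: p + \sum_i c i 0 *: ps0 0 i = Phi * T ->
    (size T <= (weight n).+1)%N /\ T`_(weight n) = a.
  move=> eqT; have sT : (size T <= (weight n).+1)%N.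
    have [->|T_neq0] := eqVneq T 0; first by rewrite size_poly0.
    by have := comb_size a c; rewrite eqT size_mul // sPhi addSn /= -addnS leq_add2l.
  by split => //; rewrite -(comb_coef a c) eqT (coef_monicM Phi_monic).
have [c c_rel ->] := border_detE p ps0 v A0.
have [T eqT T_orth] := relT _ _ c_rel; have [sT Tn] := quo _ _ _ eqT.
rewrite /christoffel_conclusion eqT mulKp // dvdp_mulr //.
have normalD : normal tmu n <-> \det A0 != 0.
  split=> [/normalP n_normal | D_neq0].
    (* A kernel vector of [A0] is a relation with [a = 0], hence gives a type II polynomial of
       degree below [weight n]. *)
    rewrite -det_tr; apply/det0P => -[u u_neq0 uA].
    have Au : A0 *m u^T = 0 by rewrite -[LHS]trmxK trmx_mul trmxK uA trmx0.
    have [|S eqS S_orth] := relT 0 u^T; first by rewrite Au scale0r addr0.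
    have [sS Sn] := quo _ _ _ eqS.
    have S0 := n_normal _ S_orth (size_le_coef0 sS Sn).
    move: eqS; rewrite S0 mulr0 scale0r add0r => /(rel_inj _ Au) u0.
    by case/eqP: u_neq0; rewrite -[u]trmxK u0 trmx0.
  apply/normalP => S S_orth sS.
  (* Conversely, [S] has no coefficient at [weight n], so its relation has [a = 0] and invertibility
     of [A0] kills the rest. *)
  have [a [e [ae_rel eqS]]] := Trel S S_orth (leqW sS).
  have [_ Sn] := quo _ _ _ eqS; rewrite nth_default // in Sn.
  move: ae_rel eqS; rewrite -Sn !scale0r !add0r => /(congr1 (mulmx (invmx A0))).
  rewrite mulKmx ?unitmxE ?unitfE // mulmx0 => ->.
  rewrite big1 => [/esym/eqP|i _]; last by rewrite mxE scale0r.
  by rewrite mulf_eq0 (negPf Phi_neq0) => /eqP.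
split => // D_neq0.
have T_typeII : normalized_typeII tmu n ((\det A0)^-1 *: T).
  have sT' : size T = (weight n).+1.
    by apply/eqP; rewrite eqn_leq sT ltnNge; apply: contra_neqN D_neq0 => sT';
       rewrite -Tn nth_default.
  split; first by apply/monicP; rewrite lead_coefZ lead_coefE sT' /= Tn mulVf.
    by rewrite size_scale ?invr_eq0.
  by rewrite -[_ *: _]addr0; apply: typeII_orth_comb => //; apply: typeII_orth0.
split=> // S S_typeII; apply/eqP; rewrite -subr_eq0; apply/eqP.
have /normalP n_normal := normalD.2 D_neq0.
by have [oS sS] := normalized_typeII_sub S_typeII T_typeII; apply: n_normal.
Qed.

(** * Bases from admissible sequences *)

(** Otherwise [P] would be a nonzero type II polynomial of too small degree for [n] raised by one in
    component [k], which is a normal index. *)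
Lemma typeII_next_neq0 (F : fieldType) (r : nat) (mu : 'I_r -> functional F) n P k :
  perfect mu -> normalized_typeII mu n P -> mu k (P * 'X^(n k)) != 0.
Proof.
move=> mu_perfect [P_monic sP oP]; apply/eqP => Pk0.
pose n' : mindex r := [ffun i => (n i + (i == k))%N].
have wn' : weight n' = (weight n).+1.
  under eq_bigr do rewrite ffunE.
  rewrite big_split /= [X in (_ + X)%N](bigD1 k) //= eqxx.
  rewrite [X in (_ + (_ + X))%N]big1 ?addn1 //.
  by move=> i /negPf ->.
suff P0 : P = 0 by move/monic_neq0: P_monic; rewrite P0 eqxx.
have /normalP := mu_perfect n'; apply; last by rewrite wn' sP.
move=> j p; rewrite ffunE; have [->|ne_jk] := eqVneq j k; last first.
  by rewrite addn0; apply: oP.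
by rewrite addn1 ltnS leq_eqVlt => /predU1P[-> //|]; apply: oP.
Qed.

(* Pigeonhole: the exponents [t j (k j)] for a given value of [k j] are distinct,
   so they fill the gaps [b k <= p < m k]. *)
Lemma admissible_unisolvent (F : fieldType) (r : nat) (mu : 'I_r -> functional F)
    (m b : mindex r) (t : nat -> mindex r) (k : nat -> 'I_r) d (G : {poly F}) :
  perfect mu -> t 0%N = m -> weight m = (weight b + d)%N ->
  (forall i, (i <= d)%N -> mi_le b (t i)) ->
  (forall i j, (i < j)%N -> (j <= d)%N -> (t j (k j) < t i (k j))%N) ->
  (size G <= weight m)%N -> typeII_orth mu b G ->
  (forall j, (0 < j <= d)%N -> mu (k j) (G * 'X^(t j (k j))) = 0) -> G = 0.
Proof.
move=> mu_perfect t0 wm le_bt lt_t sG oG lG.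
have /normalP := mu_perfect m; apply => // j p lt_p.
have [/oG //|le_bp] := ltnP p (b j).
(* An element encodes a pair [(i, p)] with [b i <= p < m i], stored as the offset [p - b i]. *)
pose gap := {i : 'I_r & 'I_(m i - b i)}.
have gapP (i : 'I_d) : (t i.+1 (k i.+1) - b (k i.+1) < m (k i.+1) - b (k i.+1))%N.
  apply: ltn_sub2r; last by rewrite -t0; apply: lt_t.
  apply: leq_ltn_trans (le_bt i.+1 (ltn_ord i) (k i.+1)) _.
  by rewrite -t0; apply: lt_t.
pose f (i : 'I_d) : gap := Tagged (fun i => 'I_(m i - b i)) (Ordinal (gapP i)).
pose g (x : gap) : 'I_r * nat := (tag x, (tagged x + b (tag x))%N).
have gf i : g (f i) = (k i.+1, t i.+1 (k i.+1)).
  by rewrite /g /f /= subnK // le_bt.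
have f_inj : injective f.
  move=> i i' eq_f; have := gf i; rewrite eq_f gf => -[ek et].
  apply/val_inj; case: (ltngtP i i') => // lt_i.
    by have := lt_t i.+1 i'.+1 lt_i (ltn_ord i'); rewrite et ek ltnn.
  by have := lt_t i'.+1 i.+1 lt_i (ltn_ord i); rewrite -et -ek ltnn.
(* There are at most [weight m - weight b = d] gaps, so the injection [f] is a bijection. *)
have card_gap : (#|{: gap}| <= #|'I_d|)%N.
  rewrite card_ord card_tagged sumnE big_map big_enum /=.
  under eq_bigr do rewrite card_ord.
  rewrite -(leq_add2l (weight b)) -wm -big_split /=; apply: leq_sum => i _.
  by have := le_bt 0%N isT i; rewrite t0; lia.
have [h hK fK] := inj_card_bij f_inj card_gap.
have lt_gap : (p - b j < m j - b j)%N by rewrite ltn_sub2r // (leq_ltn_trans le_bp).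
have := gf (h (Tagged (fun i => 'I_(m i - b i)) (Ordinal lt_gap))).
rewrite fK /g /= subnK //; move: (h _) => i [-> ->].
by apply: lG; exact: ltn_ord.
Qed.

Lemma mi_lt_weight (r : nat) (m n : mindex r) k :
  mi_le m n -> (m k < n k)%N -> (weight m < weight n)%N.
Proof.
move=> le_mn lt_k; rewrite (bigD1 k) //= [X in (_ < X)%N](bigD1 k) //=.
by rewrite -addSn leq_add // leq_sum.
Qed.

(** Passes from the shifts [s i] to the indices [t i] themselves. Since [s j <= m], truncated
    subtraction turns the strict increase of the shifts into a strict decrease of the indices. *)
Lemma admissible_indices (r : nat) (m b : mindex r) (s : nat -> mindex r) d :
  admissible m b s -> mi_le b m -> weight m = (weight b + d)%N ->
  exists k : nat -> 'I_r,
  let t i := mi_sub m (s i) in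
  [/\ t 0%N = m, forall i, (i <= d)%N -> mi_le b (t i),
      forall i j, (i < j)%N -> (j <= d)%N -> (t j (k j) < t i (k j))%N
    & forall i, (0 < i <= d)%N -> (weight (t i) < weight m)%N].
Proof.
move=> adm le_bm wm; case: adm.
have -> : (weight m - weight b)%N = d by rewrite wm addKn.
move=> s0 s_le [k lt_s].
have t0 : mi_sub m (s 0%N) = m by apply/ffunP => j; rewrite s0 !ffunE subn0.
have lt_t i j : (i < j)%N -> (j <= d)%N ->
    (mi_sub m (s j) (k j) < mi_sub m (s i) (k j))%N.
  move=> lt_ij le_jd; have := lt_s i j lt_ij le_jd.
  have [|le_sm _] := s_le j; first by rewrite le_jd (leq_ltn_trans _ lt_ij).
  by have := le_sm (k j); rewrite !ffunE; lia.
exists k => t; split=> // [[|i] le_id|i /andP[i_gt0 le_id]].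
- by rewrite /t t0.
- by have [] := s_le i.+1 le_id.
- apply: (@mi_lt_weight _ _ _ (k i)); first by move=> j; rewrite ffunE leq_subr.
  by have := lt_t 0%N i i_gt0 le_id; rewrite t0.
Qed.

(** The functionals [ell j] are triangular with nonzero diagonal on the polynomials after [P m].
    This gives independence, and it matches all values [ell j] of a given [f];
    [admissible_unisolvent] then identifies [f]. *)
Lemma admissible_basis (F : fieldType) (r : nat) (mu : 'I_r -> functional F)
    (P : mindex r -> {poly F}) (m b : mindex r) (s : nat -> mindex r) d :
  perfect mu -> (forall n, normalized_typeII mu n (P n)) ->
  admissible m b s -> mi_le b m -> weight m = (weight b + d)%N ->
  let G a (c : 'cV_d) := a *: P m + \sum_i c i 0 *: P (mi_sub m (s i.+1)) in
  [/\ forall i : 'I_d, (size (P (mi_sub m (s i.+1))) <= weight m)%N,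
      forall a c, typeII_orth mu b (G a c),
      forall c, G 0 c = 0 -> c = 0
    & forall f : {poly F}, (size f <= (weight m).+1)%N -> typeII_orth mu b f ->
        exists a c, f = G a c].
Proof.
move=> mu_perfect P_typeII adm le_bm wm G.
have [k [t0 le_bt lt_t lt_wt]] := admissible_indices adm le_bm wm.
have sP (i : 'I_d) : (size (P (mi_sub m (s i.+1))) <= weight m)%N.
  by have [_ -> _] := P_typeII (mi_sub m (s i.+1)); rewrite lt_wt //= ltn_ord.
have [Pm_monic sPm oPm] := P_typeII m.
have oG a c : typeII_orth mu b (G a c).
  apply: typeII_orth_comb; first exact: typeII_orth_le oPm.
  apply: typeII_orth_sum => i; have [_ _] := P_typeII (mi_sub m (s i.+1)).
  by apply: typeII_orth_le; apply: le_bt.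
pose ell j (f : {poly F}) := mu (k j.+1) (f * 'X^(mi_sub m (s j.+1) (k j.+1))).
pose U : 'M[F]_d := \matrix_(i, j) ell j (P (mi_sub m (s i.+1))).
have ellG (c : 'cV_d) (j : 'I_d) : ell j (G 0 c) = (c^T *m U) 0 j.
  rewrite /ell /G scale0r add0r mulr_suml linear_sum mxE /=.
  by apply: eq_bigr => i _; rewrite -scalerAl linearZ !mxE.
have U_unit : U \in unitmx.
  rewrite unitmxE unitfE det_trig.
    by apply/prodf_neq0 => i _; rewrite mxE; apply: typeII_next_neq0.
  (* For [i < j] the exponent in [ell j] lies below the component [k j.+1] of the earlier index, so
     orthogonality applies. *)
  apply/is_trig_mxP => i j lt_ij; rewrite mxE /ell.
  have [_ _] := P_typeII (mi_sub m (s i.+1)); apply.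
  by apply: lt_t.
split=> // [c G0 | f sf of_].
  have : c^T *m U = 0.
    by apply/rowP => j; rewrite -ellG G0 /ell mul0r linear0 mxE.
  move/(congr1 (mulmx^~ (invmx U))); rewrite mulmxK // mul0mx.
  by move/(congr1 trmx); rewrite trmxK trmx0.
(* Removing the top coefficient with [P m] leaves [f1]; [c] solves [ell j (G 0 c) = ell j f1] for
   all [j]. *)
pose f1 := f - f`_(weight m) *: P m.
pose c : 'cV_d := ((\row_(j < d) ell j f1) *m invmx U)^T.
exists f`_(weight m), c; apply/eqP; rewrite -subr_eq0; apply/eqP.
have f1E : f - G f`_(weight m) c = f1 - G 0 c.
  by rewrite /G scale0r add0r opprD addrA.
have sG0 : (size (G 0%R c) <= weight m)%N.
  rewrite /G scale0r add0r; apply: leq_trans (size_sum _ _ _) _.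
  by apply/bigmax_leqP => i _; apply: leq_trans (size_scale_leq _ _) _.
apply: (admissible_unisolvent mu_perfect t0 wm le_bt lt_t).
- rewrite f1E (leq_trans (size_polyD _ _)) // size_polyN geq_max sG0 andbT.
  apply: size_le_coef0.
    rewrite (leq_trans (size_polyD _ _)) // size_polyN geq_max sf /=.
    by apply: leq_trans (size_scale_leq _ _) _; rewrite sPm.
  have := monicP Pm_monic; rewrite lead_coefE sPm /= => Pmm.
  by rewrite coefB coefZ Pmm mulr1 subrr.
- by rewrite addrC -scaleN1r; apply: typeII_orth_comb.
- case=> [//|j] /= lt_jd; rewrite f1E mulrBl linearB /=.
  have := ellG c (Ordinal lt_jd); rewrite /ell /= => ->.
  by rewrite trmxK mulmxKV // mxE subrr.
Qed.

(** * Linear relations between data columns *)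

Lemma data_col_is_linear (F : fieldType) (r N : nat) (M : mindex r)
    (z : 'I_N -> F) (w : forall j : 'I_r, 'I_(M j) -> F)
    (cmu : 'I_r -> functional F) :
  linear (data_col z w cmu).
Proof.
move=> a f g; apply/colP => i; rewrite !mxE.
case: split => k; rewrite !mxE ?hornerD ?hornerZ //.
by rewrite mulrDl -scalerAl linearP.
Qed.

HB.instance Definition _ (F : fieldType) (r N : nat) (M : mindex r)
    (z : 'I_N -> F) (w : forall j : 'I_r, 'I_(M j) -> F)
    (cmu : 'I_r -> functional F) :=
  GRing.isLinear.Build F {poly F} 'cV[F]_(N + weight M) *:%R (data_col z w cmu)
    (data_col_is_linear z w cmu).

Lemma data_mxM (F : fieldType) (r N : nat) (M : mindex r)
    (z : 'I_N -> F) (w : forall j : 'I_r, 'I_(M j) -> F)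
    (cmu : 'I_r -> functional F) P m s d (c : 'cV_d) :
  data_mx z w cmu P m s d *m c =
  data_col z w cmu (\sum_i c i 0 *: P (mi_sub m (s i.+1))).
Proof.
rewrite linear_sum; apply/colP => a; rewrite summxE mxE.
by apply: eq_bigr => i _; rewrite linearZ [LHS]mulrC [in LHS]mxE [RHS]mxE.
Qed.

(** Brings a relation to the form used by [functional_vanish]: at the nodes of [w j], the second
    part of the column takes the values of a polynomial of degree below [M j - n j], hence zero if
    [M j <= n j]. *)
Lemma data_col_W_eq0 (F : fieldType) (r N : nat) (M n : mindex r)
    (z : 'I_N -> F) (w : forall j : 'I_r, 'I_(M j) -> F)
    (cmu : 'I_r -> functional F) f (c : 'cV_(\sum_(j < r) (M j - n j))) :
  data_col z w cmu f + col_mx 0 (W_diag n w *m c) = 0 <->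
  (forall k, root f (z k)) /\
  (forall j k, cmu j (f * (root_poly (w j) %/ ('X - (w j k)%:P))) =
     - \sum_(l < M j - n j) w j k ^+ l * submxcol c j l 0).
Proof.
rewrite /data_col add_col_mx addr0 -col_mx0; split.
  move=> /eq_col_mx[/colP fz /mxcolP fw]; split=> [k|j k].
    by have := fz k; rewrite !mxE => /rootP.
  have := fw j; rewrite submxcolD mxcolK W_diagM submxcol0 => /colP/(_ k).
  by rewrite !mxE => /eqP; rewrite addr_eq0 => /eqP.
case=> fz fw; congr col_mx; first by apply/colP => k; rewrite !mxE; apply/rootP.
apply/mxcolP => j; rewrite submxcolD mxcolK W_diagM submxcol0.
by apply/colP => k; rewrite !mxE fw addNr.
Qed.

(** * The determinant formula for an arbitrary index *)

Lemma christoffel_ext (F : fieldType) (r : nat)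
  (mu : 'I_r -> functional F) (mu_perfect : perfect mu)
  (N : nat) (M : mindex r)
  (z : 'I_N -> F) (w : forall j : 'I_r, 'I_(M j) -> F)
  (z_inj : injective z) (w_inj : forall j : 'I_r, injective (w j))
  (tmu cmu : 'I_r -> functional F)
  (tmuE : forall j : 'I_r,
     mulfun (root_poly (w j)) (tmu j) =1 mulfun (root_poly z) (mu j))
  (cmuE : forall j : 'I_r, mulfun (root_poly z) (cmu j) =1 tmu j)
  (P : mindex r -> {poly F})
  (P_typeII : forall n : mindex r, normalized_typeII mu n (P n))
  (n m : mindex r) (s : nat -> mindex r) :
  weight m = (weight n + N)%N ->
  mi_le (mi_sub n (mi_min n M)) m ->
  admissible m (mi_sub n (mi_min n M)) s ->
  christoffel_conclusion tmu n (root_poly z)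
    (border_det (P m) (poly_row_ext N M n P m s) (data_col z w cmu (P m))
       (data_mx_ext n z w cmu P m s))
    (\det (data_mx_ext n z w cmu P m s)).
Proof.
move=> wm le_bm adm; set b := mi_sub n (mi_min n M).
have bE j : b j = (n j - M j)%N by rewrite !ffunE; lia.
have wb : weight m = (weight b + (N + weight (mi_min n M)))%N.
  rewrite wm addnCA -big_split addnC; congr addn; apply: eq_bigr => j _.
  by rewrite bE ffunE /=; lia.
have [sP oG G_inj G_span] := admissible_basis mu_perfect P_typeII adm le_bm wb.
have [Pm_monic sPm _] := P_typeII m.
have combE a (c1 : 'cV_(N + weight (mi_min n M))) c2 :
    a *: P m + \sum_i col_mx c1 c2 i 0 *:
      (row_mx (poly_row P m s (N + weight (mi_min n M))) 0 :
         'rV_(_ + \sum_(j < r) (M j - n j))) 0 i =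
    a *: P m + \sum_i c1 i 0 *: P (mi_sub m (s i.+1)).
  rewrite big_split_ord /= [X in _ + (_ + X)]big1 ?addr0 => [|i _].
    by congr (_ + _); apply: eq_bigr => i _; rewrite col_mxEu row_mxEl mxE.
  by rewrite row_mxEr [X in _ *: X]mxE scaler0.
have relE a (c1 : 'cV_(N + weight (mi_min n M))) c2 :
    a *: data_col z w cmu (P m) +
      row_mx (data_mx z w cmu P m s (N + weight (mi_min n M)))
             (col_mx 0 (W_diag n w)) *m col_mx c1 c2 =
    data_col z w cmu (a *: P m + \sum_i c1 i 0 *: P (mi_sub m (s i.+1)))
      + col_mx 0 (W_diag n w *m c2).
  by rewrite mul_row_col data_mxM mul_col_mx mul0mx addrA linearP.
(* For [L = T tmu_j] these two identities express the values of [L] through [G = Phi T]: [mu]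
   handles multiples of [root_poly (w j)], and [cmu] the Horner quotients in the data column. *)
have tmu_mulE T j p : mulfun T (tmu j) (root_poly (w j) * 'X^p) =
    mu j (root_poly z * T * 'X^p).
  have := tmuE j (T * 'X^p); rewrite /mulfun !mulrA => <-.
  by congr (tmu j _); ring.
have cmu_mulE T j f : mulfun T (tmu j) f = cmu j (root_poly z * T * f).
  by have := cmuE j (T * f); rewrite /mulfun !mulrA => <-.
apply: (@christoffel_of_relations _ _ _ _ N).
- exact: root_poly_monic.
- exact: size_root_poly.
- by [].
- by rewrite sPm wm.
- move=> i; rewrite -wm mxE; case: split => k; rewrite !mxE ?sP //.
  by rewrite size_poly0.
- move=> a c; rewrite -[c]vsubmxK relE combE => /data_col_W_eq0[Gz Gw].
  set G := a *: P m + _ in Gz Gw *.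
  have /dvdpP[T GT] := root_poly_dvdp z_inj Gz.
  rewrite mulrC in GT; exists T => // j p lt_p.
  (* Block [j] of the coefficients of the [W] columns, moved to the other side and extended by 0 to
     all naturals. *)
  pose g l := oapp (fun i => - submxcol (dsubmx c) j i 0) 0 (insub l).
  apply: (@functional_vanish _ _ (w j) (mulfun T (tmu j)) (n j) g) => //.
    move=> k; rewrite [LHS]cmu_mulE -GT Gw -sumrN; apply: eq_bigr => l _.
    by rewrite /g valK /= mulrN.
  move=> q lt_q; rewrite [LHS]tmu_mulE -GT; apply: oG.
  by rewrite -/b bE.
- move=> T oT sT.
  have [||a [c1 GE]] := G_span (root_poly z * T).
  + have [->|T_neq0] := eqVneq T 0; first by rewrite mulr0 size_poly0.
    rewrite size_mul // ?monic_neq0 ?root_poly_monic // size_root_poly /= wm.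
    by rewrite addnC -addSn leq_add2r.
  (* For [p < n j - M j] the product [root_poly (w j) * 'X^p] has degree below [n j], where
     [T tmu_j] vanishes. *)
  + move=> j p; rewrite -/b bE => lt_p; rewrite -tmu_mulE.
    apply: (@functional_eq0 _ (mulfun T (tmu j)) _ (n j)) => [|i]; last exact: oT.
    rewrite size_mulXn ?monic_neq0 ?root_poly_monic // size_root_poly; lia.
  (* By [functional_divp_powers] these are the coefficients that make the [W] columns cancel the
     data column of [root_poly z * T]. *)
  pose c2 := \mxcol_(j < r) \col_(l < M j - n j)
    - mulfun T (tmu j) (drop_poly l.+1 (root_poly (w j))).
  exists a, (col_mx c1 c2); rewrite relE combE -GE; split=> //.
  apply/data_col_W_eq0; split=> [k | j k].
    by rewrite rootM root_root_poly.
  have Lpow := @functional_divp_powers _ _ (w j) (mulfun T (tmu j)) (n j) (oT j).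
  rewrite -cmu_mulE [LHS]Lpow -sumrN mxcolK.
  by apply: eq_bigr => l _; rewrite mxE mulrN opprK.
(* Independence of the basis gives [c1 = 0]; the [W] columns are independent by Vandermonde, as each
   block has [M j - n j <= M j] columns. *)
- move=> c; rewrite -[c]vsubmxK; set c1 := usubmx c; set c2 := dsubmx c.
  have := relE 0 c1 c2; have := combE 0 c1 c2; rewrite !scale0r !add0r.
  move=> -> -> + G0; rewrite G0.
  have c1_0 : c1 = 0 by apply: G_inj; rewrite scale0r add0r.
  move/data_col_W_eq0 => [_ Wc2]; rewrite c1_0 -[RHS]col_mx0; congr col_mx.
  apply/mxcolP => j; rewrite submxcol0; apply/colP => l; rewrite [RHS]mxE.
  pose g l := oapp (fun i => submxcol c2 j i 0) 0 (insub l).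
  have := @vandermonde_eq0 _ _ (w j) _ g (@w_inj j) (leq_subr (n j) (M j)).
  have -> : submxcol c2 j l 0 = g l by rewrite /g valK.
  apply=> // k; have := Wc2 j k; rewrite mul0r linear0 => /esym/eqP.
  rewrite oppr_eq0 => /eqP S0; rewrite -[RHS]S0.
  by apply: eq_bigr => i _; rewrite /g valK.
Qed.

(** * Reduction of the case [M <= n] to the general formula *)

(** All [M j - n j] are 0, so there is no [W] column and the cast preserves the values of the column
    indices. *)
Lemma data_mx_ext_le (F : fieldType) (r N : nat) (M n : mindex r)
    (z : 'I_N -> F) (w : forall j : 'I_r, 'I_(M j) -> F)
    (cmu : 'I_r -> functional F) (P : mindex r -> {poly F})
    (m : mindex r) (s : nat -> mindex r) :
  mi_le M n ->
  data_mx_ext n z w cmu P m s = data_mx z w cmu P m s (N + weight M).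
Proof.
move=> le_Mn; apply/matrixP => a i; rewrite castmxE cast_ord_id [LHS]mxE.
case: splitP => k /= ik; first by rewrite !mxE ik.
by have := ltn_ord k; rewrite [X in (_ < X)%N]big1 // => j _; apply/eqP/le_Mn.
Qed.

Lemma poly_row_ext_le (F : fieldType) (r N : nat) (M n : mindex r)
    (P : mindex r -> {poly F}) (m : mindex r) (s : nat -> mindex r) :
  mi_le M n -> poly_row_ext N M n P m s = poly_row P m s (N + weight M).
Proof.
move=> le_Mn; apply/rowP => i; rewrite castmxE cast_ord_id [LHS]mxE.
case: splitP => k /= ik; first by rewrite !mxE ik.
by have := ltn_ord k; rewrite [X in (_ < X)%N]big1 // => j _; apply/eqP/le_Mn.
Qed.

Theorem theorem3p3 (R : realType) (r : nat) (r_gt0 : (0 < r)%N)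
  (mu : 'I_r -> functional R[i]) (mu_perfect : perfect mu)
  (N : nat) (M : mindex r)
  (z : 'I_N -> R[i]) (w : forall j : 'I_r, 'I_(M j) -> R[i])
  (z_inj : injective z) (w_inj : forall j : 'I_r, injective (w j))
  (tmu cmu : 'I_r -> functional R[i])
  (tmuE : forall j : 'I_r,
     mulfun (root_poly (w j)) (tmu j) =1 mulfun (root_poly z) (mu j))
  (cmuE : forall j : 'I_r, mulfun (root_poly z) (cmu j) =1 tmu j)
  (P : mindex r -> {poly R[i]})
  (P_typeII : forall n : mindex r, normalized_typeII mu n (P n)) :
  (forall (n m : mindex r) (s : nat -> mindex r),
     mi_le M n ->
     weight m = (weight n + N)%N ->
     mi_le (mi_sub n M) m ->
     admissible m (mi_sub n M) s ->
     let A := data_mx z w cmu P m s (N + weight M) in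
     let ps := poly_row P m s (N + weight M) in
     christoffel_conclusion tmu n (root_poly z)
       (border_det (P m) ps (data_col z w cmu (P m)) A) (\det A))
  /\
  (forall (n m : mindex r) (s : nat -> mindex r),
     (exists j : 'I_r, (n j < M j)%N) ->
     weight m = (weight n + N)%N ->
     mi_le (mi_sub n (mi_min n M)) m ->
     admissible m (mi_sub n (mi_min n M)) s ->
     let A := data_mx_ext n z w cmu P m s in
     let ps := poly_row_ext N M n P m s in
     christoffel_conclusion tmu n (root_poly z)
       (border_det (P m) ps (data_col z w cmu (P m)) A) (\det A)).
Proof.
split=> n m s; last by move=> _ wm le_m adm; apply: christoffel_ext.
move=> le_Mn wm le_m adm A ps.
have minE : mi_min n M = M by apply/ffunP => j; rewrite ffunE; apply/minn_idPr.
rewrite /A /ps -(data_mx_ext_le _ _ _ _ _ _ le_Mn) -(poly_row_ext_le _ _ _ _ le_Mn).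
by apply: christoffel_ext; rewrite // minE.
Qed.
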